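(* Let $R$ be a commutative artin ring and $(\mathcal{C},\mathbb{E},\mathfrak{s})$ an $R$-linear Ext-finite extriangulated category which is weakly idempotent complete, has a right ARS duality $(\tau,\eta)$, and has enough projectives $\mathcal{Q}$ and enough injectives $\mathcal{J}$, both functorially finite in $\mathcal{C}$. Consider, for $C,A\in\mathcal{C}$, the non-degenerate bilinear form $$\{-,-\}:\mathbb{E}(C,A)\times\overline{\mathcal{C}}(A,\tau C)\to J,\qquad \{\delta,\overline{f}\}=\eta_C(\overline{f}_*\delta),\quad \eta_C:=\eta_{C,C}(\underline{\mathrm{id}_C}).$$ Let $\phi:\mathbb{E}^{\mathcal{Q}}(C,A)\to\mathbb{E}_{\mathcal{J}}(\tau C,\tau A)$ be the isomorphism constructed from $(\tau,\eta)$ as recalled in the context. Then for any $\delta\in\mathbb{E}^{\mathcal{Q}}(C,A)$ and $f\in\mathcal{C}(A,\tau C)$, $$\{\delta,\overline{f}\}=\{\phi(\delta),\tau(\underline{f})\},$$ where on the right the form is the one for the pair $(\tau C,\tau A)$, with $\phi(\delta)\in\mathbb{E}_{\mathcal{J}}(\tau C,\tau A)\subseteq\mathbb{E}(\tau C,\tau A)$ and $\tau(\underline{f})\in\overline{\mathcal{C}}(\tau A,\tau^2C)$.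
   Context: $J$ is the minimal injective cogenerator of the category $\mathrm{mod}R$ of finitely generated $R$-modules and $\mathbb{D}=\mathrm{Hom}_R(-,J)$. Extriangulated categories (Nakaoka–Palu). An $R$-linear extriangulated category is a triplet $(\mathcal{C},\mathbb{E},\mathfrak{s})$ where $\mathcal{C}$ is an $R$-linear additive category, (ET1) $\mathbb{E}:\mathcal{C}^{\rm op}\times\mathcal{C}\to\mathrm{Mod}R$ is an $R$-bilinear functor, (ET2) $\mathfrak{s}$ is an additive realization of $\mathbb{E}$, and (ET3), (ET4) and their duals hold. For $\delta\in\mathbb{E}(C,A)$, $c:C'\to C$, $a:A\to A'$ write $c^*\delta=\mathbb{E}(c,A)(\delta)$, $a_*\delta=\mathbb{E}(C,a)(\delta)$. A morphism $\delta\to\delta'$ from $\delta\in\mathbb{E}(C,A)$ to $\delta'\in\mathbb{E}(C',A')$ is a pair $(a:A\to A',c:C\to C')$ with $a_*\delta=c^*\delta'$. An additive realization assigns to each $\delta\in\mathbb{E}(C,A)$ an equivalence class $\mathfrak{s}(\delta)=[A\to B\to C]$ (sequences equivalent if there is an isomorphism of middle terms compatible with $\mathrm{id}_A,\mathrm{id}_C$) such that each morphism $(a,c):\delta\to\delta'$ extends to a commutative diagram between realizing sequences, $\mathfrak{s}(0)=[A\to A\oplus C\to C]$, and $\mathfrak{s}(\delta\oplus\delta')=\mathfrak{s}(\delta)\oplus\mathfrak{s}(\delta')$. (ET3): if $\mathfrak{s}(\delta)=[A\xrightarrow{x}B\xrightarrow{y}C]$, $\mathfrak{s}(\delta')=[A'\xrightarrow{x'}B'\xrightarrow{y'}C']$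 and $bx=x'a$, there is $c$ with $cy=y'b$ and $(a,c):\delta\to\delta'$ a morphism. (ET4): if $\delta\in\mathbb{E}(D,A)$, $\delta'\in\mathbb{E}(F,B)$ are realized by $A\xrightarrow{f}B\xrightarrow{f'}D$, $B\xrightarrow{g}C\xrightarrow{g'}F$, there are $E$, $d:D\to E$, $e:E\to F$, $h'\colon C\to E$ and $\delta''\in\mathbb{E}(E,A)$ realized by $A\xrightarrow{h=gf}C\xrightarrow{h'}E$ with $h'g=df'$, $eh'=g'$, such that $D\xrightarrow{d}E\xrightarrow{e}F$ realizes $f'_*\delta'$, $d^*\delta''=\delta$, $f_*\delta''=e^*\delta'$. If $\mathfrak{s}(\delta)=[A\xrightarrow{a}B\xrightarrow{b}C]$, then $A\xrightarrow{a}B\xrightarrow{b}C\overset{\delta}{\dashrightarrow}$ is an $\mathfrak{s}$-triangle. Ext-finite: every $\mathbb{E}(C,A)$ is a finitely generated $R$-module. Weakly idempotent complete: every retraction in $\mathcal{C}$ has a kernel. $P$ is projective if $\mathbb{E}(P,-)=0$; $\mathcal{C}$ has enough projectives if every $C$ admits an $\mathfrak{s}$-triangle $A\to P\to C\dashrightarrow$ with $P$ projective; injectives dually. ''Enough projectives $\mathcal{Q}$ / injectives $\mathcal{J}$'' means that $\mathcal{Q}$, $\mathcal{J}$ are the full subcategories of all projective, resp. injective, objects. ARS duality. $\mathcal{P}_{\mathbb{E}}$ (resp. $\mathcal{I}_{\mathbb{E}}$) is the ideal of morphisms $f$ with $\mathbb{E}(f,-)=0$ (resp. $\mathbb{E}(-,f)=0$);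 $\underline{\mathcal{C}}=\mathcal{C}/\mathcal{P}_{\mathbb{E}}$, $\overline{\mathcal{C}}=\mathcal{C}/\mathcal{I}_{\mathbb{E}}$, with $\underline{f}$, $\overline{f}$ the classes of $f$; $\mathbb{E}$ induces $\underline{\mathcal{C}}^{\rm op}\times\overline{\mathcal{C}}\to\mathrm{Mod}R$. A right Auslander–Reiten–Serre (ARS) duality is a pair $(\tau,\eta)$ of an $R$-linear functor $\tau:\underline{\mathcal{C}}\to\overline{\mathcal{C}}$ and a binatural isomorphism of $R$-modules $\eta_{A,B}:\underline{\mathcal{C}}(A,B)\simeq\mathbb{D}\mathbb{E}(B,\tau A)$. Thus $\eta_A:=\eta_{A,A}(\underline{\mathrm{id}_A})$ is an $R$-linear map $\mathbb{E}(A,\tau A)\to J$. Relative structures. For a full subcategory $\mathcal{D}\subseteq\mathcal{C}$: $\mathbb{E}_{\mathcal{D}}(C,A)=\{\delta\in\mathbb{E}(C,A)\mid d^*\delta=0\ \forall d:D\to C,\ D\in\mathcal{D}\}$ and $\mathbb{E}^{\mathcal{D}}(C,A)=\{\delta\in\mathbb{E}(C,A)\mid d_*\delta=0\ \forall d:A\to D,\ D\in\mathcal{D}\}$. Definition of $\phi$. Put $\mathcal{W}=\mathrm{add}(\mathcal{Q}\cup\mathcal{J})$ and let $[\mathcal{W}]$ be the ideal of morphisms factoring through $\mathcal{W}$; for the relative structures one has $\mathcal{I}_{\mathbb{E}^{\mathcal{Q}}}=\mathcal{P}_{\mathbb{E}_{\mathcal{J}}}=[\mathcal{W}]$. Then $\phi_{C,A}$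 is the composite of the natural isomorphisms $\mathbb{E}^{\mathcal{Q}}(C,A)\simeq\mathbb{D}\big((\mathcal{C}/[\mathcal{W}])(A,\tau C)\big)$, $\delta\mapsto([f]\mapsto\eta_C(f_*\delta))$, and the inverse of $\mathbb{E}_{\mathcal{J}}(\tau C,\tau A)\simeq\mathbb{D}\big((\mathcal{C}/[\mathcal{W}])(A,\tau C)\big)$, $\varepsilon\mapsto([f]\mapsto\eta_A(f^*\varepsilon))$. So $\phi_{C,A}(\delta)$ is the unique element of $\mathbb{E}_{\mathcal{J}}(\tau C,\tau A)$ with $\eta_A(f^*\phi_{C,A}(\delta))=\eta_C(f_*\delta)$ for all $f\in\mathcal{C}(A,\tau C)$. *)

(* Defs.v *)
From HB Require Import structures.
From mathcomp Require Import all_boot all_algebra.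
From mathcomp Require Import generic_quotient ring_quotient.
From mathcomp Require Import boolp classical_sets.

Set Implicit Arguments.
Unset Strict Implicit.
Unset Printing Implicit Defensive.

Import GRing.Theory.

Local Open Scope ring_scope.
Local Open Scope quotient_scope.

Declare Scope cat_scope.
Delimit Scope cat_scope with cat.
Local Open Scope cat_scope.

Section Submodules.
Variables (R : comPzRingType) (V : lmodType R).

Record submodule := Submodule {
  sub_carrier :> V -> Prop;
  submodule0 : sub_carrier 0;
  submoduleP : forall a u v,
    sub_carrier u -> sub_carrier v -> sub_carrier (a *: u + v) }.

Variable S : submodule.

Definition sub_pred : {pred V} := [pred x | `[< S x >]].

Lemma sub_predE x : x \in sub_pred <-> S x.
Proof. by split=> /asboolP. Qed.

Lemma sub_pred_closed : submod_closed sub_pred.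
Proof.
split; first exact/sub_predE/submodule0.
by move=> a u v /sub_predE Su /sub_predE Sv; apply/sub_predE/submoduleP.
Qed.

HB.instance Definition _ :=
  GRing.isSubmodClosed.Build R V sub_pred sub_pred_closed.

Definition submod := {x : V | x \in sub_pred}.

HB.instance Definition _ := SubChoice.on submod.
HB.instance Definition _ := [SubChoice_isSubLmodule of submod by <:].

Definition sub_val (x : submod) : V := val x.

Definition quotmod := Quotient.quot sub_pred.

HB.instance Definition _ := GRing.Zmodule.on quotmod.
HB.instance Definition _ := EqQuotient.on quotmod.

Definition to_quot (x : V) : quotmod := \pi_quotmod x.

Lemma to_quot_eq x y : to_quot x = to_quot y <-> S (x - y).
Proof.
rewrite -sub_predE Quotient.idealrBE; split; first by move/eqP.
by move=> h; apply/eqP.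
Qed.

Lemma to_quot_repr (u : quotmod) : to_quot (repr u) = u.
Proof. exact: reprK. Qed.

Lemma repr_to_quot x : S (repr (to_quot x) - x).
Proof. by apply/to_quot_eq; rewrite to_quot_repr. Qed.

Lemma to_quotB : {morph to_quot : x y / x - y}.
Proof. by move=> x y; rewrite /to_quot !piE. Qed.

Lemma to_quotD : {morph to_quot : x y / x + y}.
Proof. by move=> x y; rewrite /to_quot !piE. Qed.

Definition quot_scale (a : R) (u : quotmod) : quotmod := to_quot (a *: repr u).

Lemma submoduleZ a u : S u -> S (a *: u).
Proof. by move=> Su; rewrite -[_ *: _]addr0; apply: submoduleP => //; apply: submodule0. Qed.

Lemma quot_scaleE a x : quot_scale a (to_quot x) = to_quot (a *: x).
Proof.
by apply/to_quot_eq; rewrite -scalerBr; apply: submoduleZ; apply: repr_to_quot.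
Qed.

Fact quot_scaleA a b v : quot_scale a (quot_scale b v) = quot_scale (a * b) v.
Proof. by rewrite -[v]to_quot_repr !quot_scaleE scalerA. Qed.
Fact quot_scale1 : left_id 1 quot_scale.
Proof. by move=> v; rewrite -[v]to_quot_repr quot_scaleE scale1r. Qed.
Fact quot_scaleDr : right_distributive quot_scale +%R.
Proof.
move=> a u v; rewrite -[u]to_quot_repr -[v]to_quot_repr.
by rewrite -to_quotD !quot_scaleE -to_quotD scalerDr.
Qed.
Fact quot_scaleDl v : {morph quot_scale^~ v : a b / a + b}.
Proof.
by move=> a b /=; rewrite -[v]to_quot_repr !quot_scaleE -to_quotD scalerDl.
Qed.

HB.instance Definition _ := GRing.Zmodule_isLmodule.Build R quotmod
  quot_scaleA quot_scale1 quot_scaleDr quot_scaleDl.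

Lemma to_quotZ a x : to_quot (a *: x) = a *: to_quot x.
Proof. by rewrite -quot_scaleE. Qed.

Lemma to_quot_linear : linear to_quot.
Proof. by move=> a x y; rewrite to_quotD to_quotZ. Qed.

HB.instance Definition _ := GRing.isLinear.Build R V quotmod *:%R to_quot to_quot_linear.

Section Lift.
Variables (M : lmodType R) (g : {linear V -> M}).
Hypothesis g0 : forall x, S x -> g x = 0.

Definition quot_lift (_ : forall x, S x -> g x = 0) (u : quotmod) : M := g (repr u).

Lemma quot_liftE x : quot_lift g0 (to_quot x) = g x.
Proof. by apply/eqP; rewrite -subr_eq0 -linearB; apply/eqP/g0/repr_to_quot. Qed.

Lemma quot_lift_linear : linear (quot_lift g0).
Proof.
move=> a u v; rewrite -[u]to_quot_repr -[v]to_quot_repr -linearP !quot_liftE.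
by rewrite linearP.
Qed.

HB.instance Definition _ :=
  GRing.isLinear.Build R quotmod M *:%R (quot_lift g0) quot_lift_linear.

End Lift.
End Submodules.

Section Dual.
Variables (R : comPzRingType) (J M : lmodType R).

Definition dual := {linear M -> J}.

Definition dual_fun (h : dual) : {linear M -> J} := h.

Lemma dualP (g h : dual) : dual_fun g =1 dual_fun h -> g = h.
Proof.
case: g => g [[g1] [g2]]; case: h => h [[h1] [h2]] /= /funext E.
rewrite /dual_fun /= in E; subst h.
by rewrite (Prop_irrelevance g1 h1) (Prop_irrelevance g2 h2).
Qed.

Section Comb.
Variables (a : R) (g h : dual).
Definition dual_comb_fun x := a *: dual_fun g x + dual_fun h x.
Lemma dual_comb_linear : linear dual_comb_fun.
Proof.
move=> b x y; rewrite /dual_comb_fun (linearP (dual_fun g)) (linearP (dual_fun h)).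
by rewrite !scalerDr !scalerA (mulrC a) addrACA.
Qed.
HB.instance Definition _ :=
  GRing.isLinear.Build R M J *:%R dual_comb_fun dual_comb_linear.
Definition dual_comb : dual := dual_comb_fun.
End Comb.

Definition dual_zero : dual := \0%R.
Definition dual_add (g h : dual) := dual_comb 1 g h.
Definition dual_opp (g : dual) := dual_comb (-1) g dual_zero.
Definition dual_scale a (g : dual) := dual_comb a g dual_zero.

Let dual_addE g h x : dual_fun (dual_add g h) x = dual_fun g x + dual_fun h x.
Proof. by rewrite /= /dual_comb_fun scale1r. Qed.
Let dual_oppE g x : dual_fun (dual_opp g) x = - dual_fun g x.
Proof. by rewrite /= /dual_comb_fun scaleN1r addr0. Qed.
Let dual_scaleE a g x : dual_fun (dual_scale a g) x = a *: dual_fun g x.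
Proof. by rewrite /= /dual_comb_fun addr0. Qed.

Fact dual_addA : associative dual_add.
Proof. by move=> f g h; apply: dualP => x; rewrite !dual_addE addrA. Qed.
Fact dual_addC : commutative dual_add.
Proof. by move=> f g; apply: dualP => x; rewrite !dual_addE addrC. Qed.
Fact dual_add0 : left_id dual_zero dual_add.
Proof. by move=> f; apply: dualP => x; rewrite dual_addE /= add0r. Qed.
Fact dual_addN : left_inverse dual_zero dual_opp dual_add.
Proof. by move=> f; apply: dualP => x; rewrite dual_addE dual_oppE addNr. Qed.

HB.instance Definition _ := gen_eqMixin dual.
HB.instance Definition _ := gen_choiceMixin dual.
HB.instance Definition _ :=
  GRing.isZmodule.Build dual dual_addA dual_addC dual_add0 dual_addN.

Fact dual_scaleA a b v : dual_scale a (dual_scale b v) = dual_scale (a * b) v.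
Proof. by apply: dualP => x; rewrite !dual_scaleE scalerA. Qed.
Fact dual_scale1 : left_id 1 dual_scale.
Proof. by move=> v; apply: dualP => x; rewrite !dual_scaleE scale1r. Qed.
Fact dual_scaleDr : right_distributive dual_scale +%R.
Proof.
move=> a u v; apply: dualP => x.
by rewrite dual_scaleE !dual_addE !dual_scaleE scalerDr.
Qed.
Fact dual_scaleDl v : {morph dual_scale^~ v : a b / a + b}.
Proof.
by move=> a b; apply: dualP => x; rewrite dual_addE !dual_scaleE scalerDl.
Qed.

HB.instance Definition _ := GRing.Zmodule_isLmodule.Build R dual
  dual_scaleA dual_scale1 dual_scaleDr dual_scaleDl.

End Dual.

Section ModR.
Variable R : comPzRingType.
Implicit Types M X Y J : lmodType R.

Definition artinian :=
  forall I : nat -> submodule R^o,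
    (forall n x, I n.+1 x -> I n x) ->
    exists n, forall m, (n <= m)%N -> forall x, I m x <-> I n x.

Definition fin_gen M :=
  exists n (e : 'I_n -> M), forall x, exists c : 'I_n -> R,
    x = \sum_(i < n) c i *: e i.

Definition injective_mod J :=
  forall X Y (i : {linear X -> Y}) (g : {linear X -> J}),
    fin_gen X -> fin_gen Y -> injective i ->
    exists h : {linear Y -> J}, h \o i =1 g.

Definition cogenerator_mod J :=
  forall X Y (f g : {linear X -> Y}), fin_gen X -> fin_gen Y ->
    (forall h : {linear Y -> J}, h \o f =1 h \o g) -> f =1 g.

Definition injective_cogenerator J :=
  [/\ fin_gen J, injective_mod J & cogenerator_mod J].

(* Minimality: J embeds in (hence is a direct summand of) every other
   injective cogenerator of mod R. *)
Definition minimal_injective_cogenerator J :=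
  injective_cogenerator J /\
  forall J', injective_cogenerator J' ->
    exists i : {linear J -> J'}, injective i.

End ModR.

Record lincat (R : comPzRingType) := LinCat {
  obj :> Type;
  mor : obj -> obj -> lmodType R;
  idm : forall A, mor A A;
  mcomp : forall A B C, mor B C -> mor A B -> mor A C;
  comp1m : forall A B (f : mor A B), mcomp (idm B) f = f;
  compm1 : forall A B (f : mor A B), mcomp f (idm A) = f;
  mcompA : forall A B C D (h : mor C D) (g : mor B C) (f : mor A B),
    mcomp h (mcomp g f) = mcomp (mcomp h g) f;
  comp_linearr : forall A B C (g : mor B C),
    linear (fun f : mor A B => mcomp g f);
  comp_linearl : forall A B C (f : mor A B),
    linear (fun g : mor B C => mcomp g f) }.

Arguments mor {R l} A B.
Arguments idm {R l} A.
Arguments mcomp {R l A B C} g f.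
Arguments comp_linearr {R l} A {B C} g.
Arguments comp_linearl {R l A B} C f.
Notation "g ** f" := (mcomp g f)
  (at level 40, left associativity, format "g  **  f") : cat_scope.

Record linfunctor (R : comPzRingType) (K L : lincat R) := LinFunctor {
  fobj :> K -> L;
  fmap : forall A B, mor A B -> mor (fobj A) (fobj B);
  fmap1 : forall A, fmap (idm A) = idm (fobj A);
  fmap_comp : forall A B C (g : mor B C) (f : mor A B),
    fmap (g ** f) = fmap g ** fmap f;
  fmap_linear : forall A B, linear (@fmap A B) }.

Arguments fmap {R K L} F {A B} f : rename.

Section Categories.
Variables (R : comPzRingType) (K : lincat R).
Implicit Types A B C X Y Z : K.

Lemma comp0m A B C (f : mor A B) : (0 : mor B C) ** f = 0.
Proof.
have h := comp_linearl C f (-1) 0 0.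
by rewrite /= scaler0 addr0 scaleN1r addNr in h.
Qed.

Lemma compm0 A B C (g : mor B C) : g ** (0 : mor A B) = 0.
Proof.
have h := comp_linearr A g (-1) 0 0.
by rewrite /= scaler0 addr0 scaleN1r addNr in h.
Qed.

Lemma compDm A B C (f : mor A B) (g h : mor B C) :
  (g + h) ** f = g ** f + h ** f.
Proof. by have := comp_linearl C f 1 g h; rewrite /= !scale1r. Qed.

Lemma compmD A B C (h : mor B C) (f g : mor A B) :
  h ** (f + g) = h ** f + h ** g.
Proof. by have := comp_linearr A h 1 f g; rewrite /= !scale1r. Qed.

Lemma compZm A B C a (f : mor A B) (g : mor B C) :
  (a *: g) ** f = a *: (g ** f).
Proof. by have := comp_linearl C f a g 0; rewrite /= comp0m !addr0. Qed.

Lemma compmZ A B C a (g : mor B C) (f : mor A B) :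
  g ** (a *: f) = a *: (g ** f).
Proof. by have := comp_linearr A g a f 0; rewrite /= compm0 !addr0. Qed.

Lemma compBm A B C (f : mor A B) (g h : mor B C) :
  (g - h) ** f = g ** f - h ** f.
Proof. by rewrite compDm -scaleN1r compZm scaleN1r. Qed.

Lemma compmB A B C (h : mor B C) (f g : mor A B) :
  h ** (f - g) = h ** f - h ** g.
Proof. by rewrite compmD -scaleN1r compmZ scaleN1r. Qed.

Definition is_iso A B (f : mor A B) :=
  exists g : mor B A, g ** f = idm A /\ f ** g = idm B.

Definition is_zero Z := idm Z = 0.

Record biprod A B := Biprod {
  bobj : K;
  bin1 : mor A bobj;
  bin2 : mor B bobj;
  bpr1 : mor bobj A;
  bpr2 : mor bobj B;
  bpr1_in1 : bpr1 ** bin1 = idm A;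
  bpr2_in2 : bpr2 ** bin2 = idm B;
  bpr1_in2 : bpr1 ** bin2 = 0;
  bpr2_in1 : bpr2 ** bin1 = 0;
  bin_pr : bin1 ** bpr1 + bin2 ** bpr2 = idm bobj }.

Definition additive_cat :=
  (exists Z, is_zero Z) /\ forall A B, inhabited (biprod A B).

Definition bmap A A' B B' (s : biprod A A') (t : biprod B B')
    (f : mor A B) (f' : mor A' B') : mor (bobj s) (bobj t) :=
  bin1 t ** f ** bpr1 s + bin2 t ** f' ** bpr2 s.

Definition is_kernel A B X (r : mor A B) (k : mor X A) :=
  r ** k = 0 /\
  forall Y (g : mor Y A), r ** g = 0 ->
    exists h : mor Y X, k ** h = g /\ forall h', k ** h' = g -> h' = h.

Definition weakly_idempotent_complete :=
  forall A B (r : mor A B), (exists s, r ** s = idm B) ->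
    exists X (k : mor X A), is_kernel r k.

(* A full subcategory is given by its class of objects. *)

Definition contravariantly_finite (D : set K) :=
  forall C, exists X (p : mor X C), D X /\
    forall X' (p' : mor X' C), D X' -> exists h, p' = p ** h.

Definition covariantly_finite (D : set K) :=
  forall C, exists X (i : mor C X), D X /\
    forall X' (i' : mor C X'), D X' -> exists h, i' = h ** i.

Definition functorially_finite (D : set K) :=
  contravariantly_finite D /\ covariantly_finite D.

(* add D: closure of D under finite direct sums and direct summands. *)
Inductive add_closure (D : set K) : K -> Prop :=
| add_mem X of D X : add_closure D X
| add_zero Z of is_zero Z : add_closure D Z
| add_sum X Y (s : biprod X Y) of add_closure D X & add_closure D Y :
    add_closure D (bobj s)
| add_summand X Y (s : biprod X Y) of add_closure D (bobj s) : add_closure D X.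

Record ideal := Ideal {
  idl :> forall A B, submodule (mor A B);
  idl_compl : forall A B C (g : mor B C) (f : mor A B),
    idl A B f -> idl A C (g ** f);
  idl_compr : forall A B C (g : mor B C) (f : mor A B),
    idl B C g -> idl A C (g ** f) }.

Section Quotient.
Variable I : ideal.

Definition qhom A B : lmodType R := quotmod (I A B).

Definition qcomp A B C (u : qhom B C) (v : qhom A B) : qhom A C :=
  to_quot (I A C) (repr u ** repr v).

Lemma qcompE A B C (g : mor B C) (f : mor A B) :
  qcomp (to_quot (I B C) g) (to_quot (I A B) f) = to_quot (I A C) (g ** f).
Proof.
apply/to_quot_eq.
set g' := repr _; set f' := repr _.
have -> : g' ** f' - g ** f = 1 *: (g' ** (f' - f)) + (g' - g) ** f.
  by rewrite compmB compBm scale1r addrA addrNK.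
apply: submoduleP; first exact/idl_compl/repr_to_quot.
exact/idl_compr/repr_to_quot.
Qed.

Fact qcomp1m A B (u : qhom A B) : qcomp (to_quot (I B B) (idm B)) u = u.
Proof. by rewrite -[u]to_quot_repr qcompE comp1m. Qed.
Fact qcompm1 A B (u : qhom A B) : qcomp u (to_quot (I A A) (idm A)) = u.
Proof. by rewrite -[u]to_quot_repr qcompE compm1. Qed.
Fact qcompA A B C X (w : qhom C X) (v : qhom B C) (u : qhom A B) :
  qcomp w (qcomp v u) = qcomp (qcomp w v) u.
Proof.
by rewrite -[u]to_quot_repr -[v]to_quot_repr -[w]to_quot_repr !qcompE mcompA.
Qed.
Fact qcomp_linearr A B C (v : qhom B C) :
  linear (fun u : qhom A B => qcomp v u).
Proof.
move=> a u u' /=; rewrite -[u]to_quot_repr -[u']to_quot_repr -[v]to_quot_repr.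
by rewrite -linearP !qcompE -linearP comp_linearr.
Qed.
Fact qcomp_linearl A B C (u : qhom A B) :
  linear (fun v : qhom B C => qcomp v u).
Proof.
move=> a v v' /=; rewrite -[u]to_quot_repr -[v]to_quot_repr -[v']to_quot_repr.
by rewrite -linearP !qcompE -linearP comp_linearl.
Qed.

Definition quotcat : lincat R :=
  LinCat qcomp1m qcompm1 qcompA qcomp_linearr qcomp_linearl.

Definition qclass A B (f : mor A B) : @mor R quotcat A B := to_quot (I A B) f.

Lemma qclass_comp A B C (g : mor B C) (f : mor A B) :
  qclass (g ** f) = qclass g ** qclass f.
Proof. by rewrite /= qcompE. Qed.

End Quotient.
End Categories.

Arguments qclass {R K} I {A B} f.

(* An R-bilinear functor K^op x K -> Mod R; push a d and pull c d are the
   elements a_* d and c^* d. *)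
Record bifunctor (R : comPzRingType) (K : lincat R) := Bifunctor {
  bval :> K -> K -> lmodType R;
  push : forall C A A', mor A A' -> bval C A -> bval C A';
  pull : forall C C' A, mor C' C -> bval C A -> bval C' A;
  push1 : forall C A (d : bval C A), push (idm A) d = d;
  pull1 : forall C A (d : bval C A), pull (idm C) d = d;
  push_comp : forall C A A' A'' (g : mor A' A'') (f : mor A A') (d : bval C A),
    push (g ** f) d = push g (push f d);
  pull_comp : forall C C' C'' A (g : mor C' C) (f : mor C'' C') (d : bval C A),
    pull (g ** f) d = pull f (pull g d);
  push_pull : forall C C' A A' (a : mor A A') (c : mor C' C) (d : bval C A),
    push a (pull c d) = pull c (push a d);
  push_linear : forall C A A' (a : mor A A'), linear (@push C A A' a);
  pull_linear : forall C C' A (c : mor C' C), linear (@pull C C' A c);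
  push_linearl : forall C A A' (d : bval C A),
    linear (fun a : mor A A' => push a d);
  pull_linearl : forall C C' A (d : bval C A),
    linear (fun c : mor C' C => pull c d) }.

Arguments push {R K b C A A'} a d.
Arguments pull {R K b C C' A} c d.
Arguments push_linear {R K b} C {A A'} a.
Arguments pull_linear {R K b C C'} A c.
Arguments push_linearl {R K b C A} A' d.
Arguments pull_linearl {R K b C} C' {A} d.

Section Extensions.
Variables (R : comPzRingType) (K : lincat R) (E : bifunctor K).
Implicit Types A B C D F : K.

Definition ext_morphism A C A' C' (d : E C A) (d' : E C' A')
    (a : mor A A') (c : mor C C') :=
  push a d = pull c d'.

Definition seq_equiv A B B' C (x : mor A B) (y : mor B C)
    (x' : mor A B') (y' : mor B' C) :=
  exists b : mor B B', [/\ is_iso b, b ** x = x' & y' ** b = y].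

(* The element of E(C (+) C', A (+) A') with components (d, 0, 0, d'). *)
Definition ext_sum A A' C C' (s : biprod A A') (t : biprod C C')
    (d : E C A) (d' : E C' A') : E (bobj t) (bobj s) :=
  push (bin1 s) (pull (bpr1 t) d) + push (bin2 s) (pull (bpr2 t) d').

(* realizes x y d stands for s(d) = [A -x-> B -y-> C]. *)
Variable realizes : forall A B C, mor A B -> mor B C -> E C A -> Prop.

Definition additive_realization :=
  [/\ (forall A C (d : E C A),
         exists B (x : mor A B) (y : mor B C), realizes x y d),
      (forall A B B' C (x : mor A B) (y : mor B C) (x' : mor A B')
          (y' : mor B' C) (d : E C A),
         realizes x y d -> (realizes x' y' d <-> seq_equiv x y x' y')),
      (forall A B C A' B' C' (x : mor A B) (y : mor B C) (x' : mor A' B')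
          (y' : mor B' C') (d : E C A) (d' : E C' A')
          (a : mor A A') (c : mor C C'),
         realizes x y d -> realizes x' y' d' -> ext_morphism d d' a c ->
         exists b : mor B B', b ** x = x' ** a /\ y' ** b = c ** y),
      (forall A C (s : biprod A C), realizes (bin1 s) (bpr2 s) (0 : E C A)) &
      (forall A B C A' B' C' (x : mor A B) (y : mor B C) (x' : mor A' B')
          (y' : mor B' C') (d : E C A) (d' : E C' A')
          (s : biprod A A') (t : biprod B B') (u : biprod C C'),
         realizes x y d -> realizes x' y' d' ->
         realizes (bmap s t x x') (bmap t u y y') (ext_sum s u d d'))].

Definition ET3 :=
  forall A B C A' B' C' (x : mor A B) (y : mor B C) (x' : mor A' B')
      (y' : mor B' C') (d : E C A) (d' : E C' A')
      (a : mor A A') (b : mor B B'),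
    realizes x y d -> realizes x' y' d' -> b ** x = x' ** a ->
    exists c : mor C C', c ** y = y' ** b /\ ext_morphism d d' a c.

Definition ET3op :=
  forall A B C A' B' C' (x : mor A B) (y : mor B C) (x' : mor A' B')
      (y' : mor B' C') (d : E C A) (d' : E C' A')
      (b : mor B B') (c : mor C C'),
    realizes x y d -> realizes x' y' d' -> c ** y = y' ** b ->
    exists a : mor A A', b ** x = x' ** a /\ ext_morphism d d' a c.

Definition ET4 :=
  forall A B C D F (f : mor A B) (f' : mor B D) (g : mor B C) (g' : mor C F)
      (d1 : E D A) (d2 : E F B),
    realizes f f' d1 -> realizes g g' d2 ->
    exists E0 (d : mor D E0) (e : mor E0 F) (h' : mor C E0) (d3 : E E0 A),
      [/\ realizes (g ** f) h' d3,
          h' ** g = d ** f' /\ e ** h' = g',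
          realizes d e (push f' d2),
          pull d d3 = d1 &
          push f d3 = pull e d2].

(* ET4 for the opposite category: all arrows reversed, push and pull
   exchanged. *)
Definition ET4op :=
  forall A B C D F (f : mor B A) (f' : mor D B) (g : mor C B) (g' : mor F C)
      (d1 : E A D) (d2 : E B F),
    realizes f' f d1 -> realizes g' g d2 ->
    exists E0 (d : mor E0 D) (e : mor F E0) (h' : mor E0 C) (d3 : E A E0),
      [/\ realizes h' (f ** g) d3,
          g ** h' = f' ** d /\ h' ** e = g',
          realizes e d (pull f' d2),
          push d d3 = d1 &
          pull f d3 = push e d2].

End Extensions.

Record extricat (R : comPzRingType) := Extricat {
  ext_cat :> lincat R;
  EE : bifunctor ext_cat;
  realizes : forall A B C : ext_cat, mor A B -> mor B C -> EE C A -> Prop;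
  ext_additive : additive_cat ext_cat;
  ext_realization : additive_realization realizes;
  ext_ET3 : ET3 realizes;
  ext_ET3op : ET3op realizes;
  ext_ET4 : ET4 realizes;
  ext_ET4op : ET4op realizes }.

Arguments EE {R} e.
Arguments realizes {R e A B C} x y d.

Section ExtricatTheory.
Variables (R : comPzRingType) (K : extricat R).
Local Notation E := (EE K).
Implicit Types A B C : K.

Lemma push0m A A' C (d : E C A) : push (0 : mor A A') d = 0.
Proof.
have h := push_linearl A' d (-1) 0 0.
by rewrite /= scaler0 addr0 scaleN1r addNr in h.
Qed.

Lemma pull0m A C C' (d : E C A) : pull (0 : mor C' C) d = 0.
Proof.
have h := pull_linearl C' d (-1) 0 0.
by rewrite /= scaler0 addr0 scaleN1r addNr in h.
Qed.

Lemma push0 A A' C (a : mor A A') : push a (0 : E C A) = 0.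
Proof.
have h := push_linear C a (-1 : R) (0 : E C A) 0.
by rewrite /= scaler0 addr0 scaleN1r addNr in h.
Qed.

Lemma pull0 A C C' (c : mor C' C) : pull c (0 : E C A) = 0.
Proof.
have h := pull_linear A c (-1 : R) (0 : E C A) 0.
by rewrite /= scaler0 addr0 scaleN1r addNr in h.
Qed.

Lemma pushDm A A' C (a b : mor A A') (d : E C A) :
  push (a + b) d = push a d + push b d.
Proof. by have := push_linearl A' d 1 a b; rewrite /= !scale1r. Qed.

Lemma pullDm A C C' (c b : mor C' C) (d : E C A) :
  pull (c + b) d = pull c d + pull b d.
Proof. by have := pull_linearl C' d 1 c b; rewrite /= !scale1r. Qed.

Definition ext_finite := forall A C, fin_gen (E C A).

Definition proj_obj : set K := fun P => forall A (d : E P A), d = 0.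
Definition inj_obj : set K := fun I => forall C (d : E C I), d = 0.

Definition enough_projectives :=
  forall C, exists A P (x : mor A P) (y : mor P C) (d : E C A),
    proj_obj P /\ realizes x y d.

Definition enough_injectives :=
  forall A, exists I C (x : mor A I) (y : mor I C) (d : E C A),
    inj_obj I /\ realizes x y d.

Fact relE_down_subproof (D : set K) C A :
  let P := fun d : E C A => forall X (c : mor X C), D X -> pull c d = 0 in
  P 0 /\ forall a u v, P u -> P v -> P (a *: u + v).
Proof.
split=> [X c _|a u v Pu Pv X c DX]; first exact: pull0.
by rewrite pull_linear Pu // Pv // scaler0 addr0.
Qed.

Fact relE_up_subproof (D : set K) C A :
  let P := fun d : E C A => forall X (a : mor A X), D X -> push a d = 0 in
  P 0 /\ forall a u v, P u -> P v -> P (a *: u + v).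
Proof.
split=> [X c _|a u v Pu Pv X c DX]; first exact: push0.
by rewrite push_linear Pu // Pv // scaler0 addr0.
Qed.

(* relE_down D C A is E_D(C, A); relE_up D C A is E^D(C, A). *)
Definition relE_down (D : set K) C A : submodule (E C A) :=
  Submodule (relE_down_subproof D C A).1 (relE_down_subproof D C A).2.

Definition relE_up (D : set K) C A : submodule (E C A) :=
  Submodule (relE_up_subproof D C A).1 (relE_up_subproof D C A).2.

Fact idealP_subproof A B :
  let P := fun f : mor A B => forall X (d : E B X), pull f d = 0 in
  P 0 /\ forall a u v, P u -> P v -> P (a *: u + v).
Proof.
split=> [X d|a u v Pu Pv X d]; first exact: pull0m.
by have := pull_linearl A d a u v; rewrite /= Pu Pv scaler0 addr0.
Qed.

Fact idealI_subproof A B :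
  let P := fun f : mor A B => forall X (d : E X A), push f d = 0 in
  P 0 /\ forall a u v, P u -> P v -> P (a *: u + v).
Proof.
split=> [X d|a u v Pu Pv X d]; first exact: push0m.
by have := push_linearl B d a u v; rewrite /= Pu Pv scaler0 addr0.
Qed.

Definition subP A B : submodule (mor A B) :=
  Submodule (idealP_subproof A B).1 (idealP_subproof A B).2.

Fact idealP_compl A B C (g : mor B C) (f : mor A B) :
  subP A B f -> subP A C (g ** f).
Proof. by move=> hf X d; rewrite pull_comp hf. Qed.

Fact idealP_compr A B C (g : mor B C) (f : mor A B) :
  subP B C g -> subP A C (g ** f).
Proof. by move=> hg X d; rewrite pull_comp hg pull0. Qed.

Definition idealP : ideal K := Ideal idealP_compl idealP_compr.

Definition subI A B : submodule (mor A B) :=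
  Submodule (idealI_subproof A B).1 (idealI_subproof A B).2.

Fact idealI_compl A B C (g : mor B C) (f : mor A B) :
  subI A B f -> subI A C (g ** f).
Proof. by move=> hf X d; rewrite push_comp hf push0. Qed.

Fact idealI_compr A B C (g : mor B C) (f : mor A B) :
  subI B C g -> subI A C (g ** f).
Proof. by move=> hg X d; rewrite push_comp hg. Qed.

Definition idealI : ideal K := Ideal idealI_compl idealI_compr.

Definition addW : set K := add_closure (proj_obj `|` inj_obj)%classic.

Definition factors_through (D : set K) A B (f : mor A B) :=
  exists W (a : mor A W) (b : mor W B), D W /\ f = b ** a.

Fact idealW_subproof A B :
  let P := @factors_through addW A B in
  P 0 /\ forall a u v, P u -> P v -> P (a *: u + v).
Proof.
have [[Z Z0] hb] := ext_additive K.
split=> [|a u v [W [p [q [hW ->]]]] [W' [p' [q' [hW' ->]]]]].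
  by exists Z, 0, 0; split; [apply: add_zero|rewrite comp0m].
have [s] := hb W W'.
exists (bobj s), (bin1 s ** p + bin2 s ** p'), ((a *: q) ** bpr1 s + q' ** bpr2 s).
split; first exact: add_sum.
rewrite compDm !compmD.
rewrite -!mcompA (mcompA (bpr1 s)) bpr1_in1 comp1m (mcompA (bpr1 s)) bpr1_in2.
rewrite (mcompA (bpr2 s)) bpr2_in1 (mcompA (bpr2 s) (bin2 s)) bpr2_in2 comp1m.
by rewrite !comp0m !compm0 addr0 add0r compZm.
Qed.

Definition subW A B : submodule (mor A B) :=
  Submodule (idealW_subproof A B).1 (idealW_subproof A B).2.

Fact idealW_compl A B C (g : mor B C) (f : mor A B) :
  subW A B f -> subW A C (g ** f).
Proof. by case=> W [p [q [hW ->]]]; exists W, p, (g ** q); rewrite mcompA. Qed.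

Fact idealW_compr A B C (g : mor B C) (f : mor A B) :
  subW B C g -> subW A C (g ** f).
Proof. by case=> W [p [q [hW ->]]]; exists W, (p ** f), q; rewrite mcompA. Qed.

Definition idealW : ideal K := Ideal idealW_compl idealW_compr.

(* ul_cat = K/P_E and ol_cat = K/I_E; ul f and ol f are the classes of f. *)
Definition ul_cat := quotcat idealP.
Definition ol_cat := quotcat idealI.
Definition W_cat := quotcat idealW.

Definition ul A B (f : mor A B) : @mor R ul_cat A B := qclass idealP f.
Definition ol A B (f : mor A B) : @mor R ol_cat A B := qclass idealI f.

(* The functor induced by E on (C/P_E)^op x (C/I_E). *)
Definition upull C C' A (u : @mor R ul_cat C' C) (d : E C A) : E C' A :=
  pull (repr u) d.
Definition opush C A A' (u : @mor R ol_cat A A') (d : E C A) : E C A' :=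
  push (repr u) d.

Lemma upullE C C' A (c : mor C' C) (d : E C A) : upull (ul c) d = pull c d.
Proof.
rewrite /upull -[repr _](subrK c) pullDm.
by rewrite (repr_to_quot (idealP C' C) c) add0r.
Qed.

Lemma opushE C A A' (a : mor A A') (d : E C A) : opush (ol a) d = push a d.
Proof.
rewrite /opush -[repr _](subrK a) pushDm.
by rewrite (repr_to_quot (idealI A A') a) add0r.
Qed.

End ExtricatTheory.

Record right_ARS (R : comPzRingType) (J : lmodType R) (K : extricat R) :=
  RightARS {
    tau :> linfunctor (ul_cat K) (ol_cat K);
    eta : forall A B : K,
      {linear @mor R (ul_cat K) A B -> dual J (EE K B (tau A))};
    eta_bij : forall A B, bijective (eta A B);
    eta_natl : forall (A A' B : K) (u : @mor R (ul_cat K) A' A)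
        (w : @mor R (ul_cat K) A B) (d : EE K B (tau A')),
      dual_fun (eta A' B (w ** u)) d
        = dual_fun (eta A B w) (opush (fmap tau u) d);
    eta_natr : forall (A B B' : K) (v : @mor R (ul_cat K) B B')
        (w : @mor R (ul_cat K) A B) (d : EE K B' (tau A)),
      dual_fun (eta A B' (v ** w)) d = dual_fun (eta A B w) (upull v d) }.

Arguments eta {R J K} T A B : rename.
Arguments eta_bij {R J K} T A B : rename.
Arguments eta_natl {R J K} T {A A' B} u w d : rename.
Arguments eta_natr {R J K} T {A B B'} v w d : rename.

Section Phi.
Variables (R : comPzRingType) (J : lmodType R) (K : extricat R).
Variable T : right_ARS J K.
Local Notation E := (EE K).
Implicit Types A B C : K.

Definition eta_id A : {linear E A (T A) -> J} :=
  dual_fun (eta T A A (idm (A : ul_cat K))).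

Definition bracket C A (d : E C A) (u : @mor R (ol_cat K) A (T C)) : J :=
  eta_id C (opush u d).

Lemma push_addW C A W (d : submod (relE_up (@proj_obj R K) C A))
    (a : mor A W) : addW W -> push a (sub_val d) = 0.
Proof.
have dQ := (sub_predE _ _).1 (valP d).
move=> hW; elim: hW a => {W} [W [PW|IW] a|W W0 a|X Y s _ IX _ IY a|X Y s _ IZ a].
- exact: dQ.
- exact: IW.
- by rewrite -[a]comp1m W0 comp0m push0m.
- rewrite -[a]comp1m -bin_pr compDm pushDm -!mcompA !(push_comp (bin1 s)) IX.
  by rewrite push_comp IY !push0 addr0.
- by rewrite -[a]comp1m -(bpr1_in1 s) -mcompA push_comp IZ push0.
Qed.

Lemma pull_addW C A W (d : submod (relE_down (@inj_obj R K) C A))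
    (c : mor W C) : addW W -> pull c (sub_val d) = 0.
Proof.
have dI := (sub_predE _ _).1 (valP d).
move=> hW; elim: hW c => {W} [W [PW|IW] c|W W0 c|X Y s _ IX _ IY c|X Y s _ IZ c].
- exact: PW.
- exact: dI.
- by rewrite -[c]compm1 W0 compm0 pull0m.
- rewrite -[c]compm1 -bin_pr compmD pullDm !mcompA !(pull_comp _ (bpr1 s)) IX.
  by rewrite pull_comp IY !pull0 addr0.
- by rewrite -[c]compm1 -(bpr1_in1 s) mcompA pull_comp IZ pull0.
Qed.

Section PhiUp.
Variables (C A : K) (d : submod (relE_up (@proj_obj R K) C A)).

Definition phi_up_fun (f : mor A (T C : K)) : J := eta_id C (push f (sub_val d)).

Fact phi_up_linear : linear phi_up_fun.
Proof.
move=> a f g; rewrite /phi_up_fun -linearP; congr (eta_id C _).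
exact: (push_linearl _ (sub_val d)).
Qed.

HB.instance Definition _ :=
  GRing.isLinear.Build R _ J *:%R phi_up_fun phi_up_linear.

Fact phi_up0 f : idealW K A (T C : K) f -> phi_up_fun f = 0.
Proof.
case=> W [a [b [hW ->]]].
by rewrite /phi_up_fun push_comp push_addW // push0 linear0.
Qed.

(* [f] |-> eta_C (f_* d) *)
Definition phi_up : dual J (@mor R (W_cat K) A (T C)) := quot_lift phi_up0.

Lemma phi_upE (f : mor A (T C : K)) :
  dual_fun phi_up (qclass (idealW K) f) = eta_id C (push f (sub_val d)).
Proof. exact: quot_liftE. Qed.

End PhiUp.

Section PhiDown.
Variables (C A : K).
Variable e : submod (relE_down (@inj_obj R K) (T C : K) (T A : K)).

Definition phi_down_fun (f : mor A (T C : K)) : J := eta_id A (pull f (sub_val e)).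

Fact phi_down_linear : linear phi_down_fun.
Proof.
move=> a f g; rewrite /phi_down_fun -linearP; congr (eta_id A _).
exact: (pull_linearl _ (sub_val e)).
Qed.

HB.instance Definition _ :=
  GRing.isLinear.Build R _ J *:%R phi_down_fun phi_down_linear.

Fact phi_down0 f : idealW K A (T C : K) f -> phi_down_fun f = 0.
Proof.
case=> W [a [b [hW ->]]].
by rewrite /phi_down_fun pull_comp pull_addW // pull0 linear0.
Qed.

(* [f] |-> eta_A (f^* e) *)
Definition phi_down : dual J (@mor R (W_cat K) A (T C)) := quot_lift phi_down0.

Lemma phi_downE (f : mor A (T C : K)) :
  dual_fun phi_down (qclass (idealW K) f) = eta_id A (pull f (sub_val e)).
Proof. exact: quot_liftE. Qed.

End PhiDown.

(* phi = phi_down^-1 o phi_up. The inverse is taken by choice (with junk value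
   0), since the bijectivity of phi_down depends on the hypotheses on R, J and K
   that make finitely generated R-modules reflexive for Hom_R(-, J). *)
Definition phi C A (d : submod (relE_up (@proj_obj R K) C A)) :
    submod (relE_down (@inj_obj R K) (T C : K) (T A : K)) :=
  xget 0 [set e | phi_down e = phi_up d]%classic.

End Phi.

Arguments eta_id {R J K} T A.
Arguments bracket {R J K} T {C A} d u.
Arguments phi_up {R J K} T {C A} d.
Arguments phi_down {R J K} T {C A} e.
Arguments phi {R J K} T {C A} d.

(* Main.v *)
(** By naturality of [eta] in both variables, the right-hand side equals
    [eta_A (f^* phi(d))], which is [eta_C (f_* d)] by the defining equation of
    [phi]; the substance is that this equation has a solution [e].  As [d] is
    killed by pushing to projectives, [f |-> eta_C (f_* d)] descends to the stable
    Hom, i.e. to a functional on [D E(tau C, tau A)], and Matlis biduality for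
    the finitely generated module [E(tau C, tau A)] makes it evaluation at some
    [e].  For [c : I -> tau C] with [I] injective, all functionals vanish on
    [c^* e] because [E(C, I) = 0], so [e] lies in [E_J].

    Biduality rests on one consequence of the minimality of [J]: each simple
    module occurs only once in the socle of [J]. *)

Require Import Defs.
From HB Require Import structures.
From mathcomp Require Import all_boot all_algebra.
From mathcomp Require Import boolp classical_sets.

Set Implicit Arguments.
Unset Strict Implicit.
Unset Printing Implicit Defensive.

Import GRing.Theory.
Local Open Scope ring_scope.
Local Open Scope cat_scope.

(** Without an extremal element, dependent choice builds a strictly increasing sequence in [P]. *)
Lemma extremal_of_stable (T : Type) (le : T -> T -> Prop) (P : T -> Prop) :
  (forall s : nat -> T, (forall n, le (s n) (s n.+1)) ->
     exists n, le (s n.+1) (s n)) ->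
  (exists x, P x) ->
  exists2 x, P x & forall y, P y -> le x y -> le y x.
Proof.
move=> stab [x0 Px0]; apply: contrapT => noext.
have step (x : {x | P x}) : exists y : {x | P x},
    le (sval x) (sval y) /\ ~ le (sval y) (sval x).
  case: x => x Px; apply: contrapT => H; apply: noext; exists x => // y Py xy.
  by apply: contrapT => yx; apply: H; exists (exist _ y Py).
have [g gP] := choice step.
pose s n := iter n g (exist _ x0 Px0).
have [n|n] := stab (fun n => sval (s n)); first by case: (gP (s n)).
by case: (gP (s n)).
Qed.

(** * Chain conditions for finitely generated modules *)

Section FinitelyGenerated.
Variables (R : comPzRingType) (V : lmodType R).
Implicit Types (I N : submodule V) (x y : V).

Lemma submoduleD N x y : N x -> N y -> N (x + y).
Proof. by rewrite -{2}[x]scale1r; apply: submoduleP. Qed.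

Lemma submoduleB N x y : N x -> N y -> N (x - y).
Proof. by move=> Nx Ny; rewrite addrC -scaleN1r; apply: submoduleP. Qed.

Fact span_subproof (e : nat -> V) n :
  let P := fun x => exists c : nat -> R, x = \sum_(i < n) c i *: e i in
  P 0 /\ forall a x y, P x -> P y -> P (a *: x + y).
Proof.
split=> [|a _ _ [c ->] [d ->]].
  by exists (fun=> 0); rewrite big1 // => i _; rewrite scale0r.
exists (fun i => a * c i + d i); rewrite scaler_sumr -big_split /=.
by apply: eq_bigr => i _; rewrite scalerDl scalerA.
Qed.

(** Generators are indexed by [nat], so that dropping the last one only changes [n]. *)
Definition span_submodule e n : submodule V :=
  Submodule (span_subproof e n).1 (span_subproof e n).2.

Fact meet_subproof N I :
  let P := fun x => N x /\ I x in
  P 0 /\ forall a x y, P x -> P y -> P (a *: x + y).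
Proof.
split=> [|a x y [Nx Ix] [Ny Iy]]; split; try exact: submodule0.
  exact: submoduleP.
exact: submoduleP.
Qed.

Definition meet N I : submodule V :=
  Submodule (meet_subproof N I).1 (meet_subproof N I).2.

Fact colon_subproof N I x :
  let P := fun r : R^o => exists2 s, N s & I ((r : R) *: x + s) in
  P 0 /\ forall a u v, P u -> P v -> P (a *: u + v).
Proof.
split=> [|a u v [s Ns Is] [t Nt It]].
  by exists 0; rewrite ?scale0r ?addr0; apply: submodule0.
exists (a *: s + t); first exact: submoduleP.
have -> : (a *: u + v : R) *: x + (a *: s + t)
        = a *: ((u : R) *: x + s) + ((v : R) *: x + t).
  by rewrite scalerDl scalerDr scalerA addrACA.
exact: submoduleP.
Qed.

(** This is the ideal [(N + I : x)], the coefficients of [x] in elements of [I] modulo [N]. *)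
Definition colon N I x : submodule R^o :=
  Submodule (colon_subproof N I x).1 (colon_subproof N I x).2.

Lemma span_full : fin_gen V -> exists e n, forall x, span_submodule e n x.
Proof.
case=> n [e eP]; exists (fun i => if insub i is Some j then e j else 0), n => x.
have [c ->] := eP x.
exists (fun i => if insub i is Some j then c j else 0).
by apply: eq_bigr => i _; rewrite valK.
Qed.

End FinitelyGenerated.

(** The boolean lets one induction serve the artinian and the noetherian condition. *)
Definition chain (R : comPzRingType) (V : lmodType R) (descending : bool)
    (I : nat -> submodule V) :=
  forall n x, if descending then I n.+1 x -> I n x else I n x -> I n.+1 x.

Definition stabilizes (R : comPzRingType) (V : lmodType R)
    (I : nat -> submodule V) :=
  exists n, forall m, (n <= m)%N -> forall x, I m x <-> I n x.

Lemma chain_le (R : comPzRingType) (V : lmodType R) b (I : nat -> submodule V) :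
  chain b I -> forall n m x, (n <= m)%N ->
    if b then I m x -> I n x else I n x -> I m x.
Proof.
move=> cI n m x /subnK <-; elim: (m - n)%N => [|k IH]; first by case: b cI.
by case: b cI IH => cI IH; move: (cI (k + n)%N x); rewrite addSn; tauto.
Qed.

(** Induction on [n] for chains inside the span of the first [n] generators: such a chain is
    controlled by its trace on the smaller span and by its ideals of coefficients of the last
    generator. *)
Lemma fin_gen_chain_stabilizes (R : comPzRingType) b :
  (forall I : nat -> submodule R^o, chain b I -> stabilizes I) ->
  forall V : lmodType R, fin_gen V ->
  forall I : nat -> submodule V, chain b I -> stabilizes I.
Proof.
move=> stabR V /span_full [e [n spanV]] I cI.
have : forall m x, I m x -> span_submodule e n x by [].
elim: n I cI {spanV} => [|n IH] I cI spanI.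
  exists 0%N => m _ x; split=> Ix; have [c] := spanI _ _ Ix;
    by rewrite big_ord0 => ->; apply: submodule0.
have [|m x []|n1 st1] := IH (fun k => meet (span_submodule e n) (I k)) => //.
  by move=> k x; move: (cI k x); case: b {cI stabR IH} => /=; tauto.
have [|n2 st2] := stabR (fun k => colon (span_submodule e n) (I k) (e n)).
  move=> k r; case: b {stabR IH} cI => cI [s Ns Is]; exists s => //;
    exact: (cI k).
have key k l : (forall x, I k x -> I l x) ->
    (forall x, meet (span_submodule e n) (I l) x -> meet (span_submodule e n) (I k) x) ->
    (forall r, colon (span_submodule e n) (I l) (e n) r ->
       colon (span_submodule e n) (I k) (e n) r) ->
    forall x, I l x -> I k x.
  move=> kl mlk clk x Ix; have [c xE] := spanI _ _ Ix.
  rewrite big_ord_recr /= addrC in xE.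
  set s := \sum_(i < n) _ in xE.
  have Ns : span_submodule e n s by exists c.
  have [|t Nt It] := clk (c n); first by exists s; rewrite // -xE.
  (* Modular law: the first summand lies in [I k], the second in the smaller span and in [I l],
     hence in [I k]. *)
  have -> : x = (c n *: e n + t) + (s - t) by rewrite addrACA subrr addr0 addrC xE addrC.
  apply: submoduleD => //; apply: (mlk _ _).2; split; first exact: submoduleB.
  have -> : s - t = x - (c n *: e n + t) by rewrite xE opprD addrACA subrr add0r.
  exact/submoduleB/kl.
exists (maxn n1 n2) => m hm x.
have [h1 h2] : (n1 <= m)%N /\ (n2 <= m)%N by apply/andP; rewrite -geq_max.
set k := maxn n1 n2 in hm *.
have eq1 y : meet (span_submodule e n) (I m) y <-> meet (span_submodule e n) (I k) y.
  by rewrite (st1 m) // (st1 k) ?leq_maxl.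
have eq2 y : colon (span_submodule e n) (I m) (e n) y <-> colon (span_submodule e n) (I k) (e n) y.
  by rewrite (st2 m) // (st2 k) ?leq_maxr.
have le y := chain_le cI y hm.
case: b {cI stabR IH} le => le; split; try exact: le.
- by apply: key => // y; [move/eq1 | move/eq2].
- by apply: key => // y; [move/eq1 | move/eq2].
Qed.

(** * Linear maps and adjunction of an element to a submodule *)

Definition linear_of (R : comPzRingType) (V W : lmodType R) (f : V -> W)
    (lin_f : linear f) : {linear V -> W} :=
  HB.pack f (GRing.isLinear.Build R V W *:%R f lin_f).

Section LinearMaps.
Variables (R : comPzRingType) (V W : lmodType R).

Fact corestrict_subproof (N : submodule W) (f : {linear V -> W})
    (fN : forall x, N (f x)) :
  linear (fun x => Sub (f x) ((sub_predE N (f x)).2 (fN x)) : submod N).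
Proof. by move=> a x y; apply: val_inj; apply: (linearP f). Qed.

Definition corestrict N f fN := linear_of (@corestrict_subproof N f fN).

Fact image_subproof (f : {linear V -> W}) :
  let P := fun y => exists x, y = f x in
  P 0 /\ forall a x y, P x -> P y -> P (a *: x + y).
Proof.
split=> [|a _ _ [x ->] [y ->]]; first by exists 0; rewrite linear0.
by exists (a *: x + y); rewrite linearP.
Qed.

Definition image_submodule (f : {linear V -> W}) : submodule W :=
  Submodule (image_subproof f).1 (image_subproof f).2.

Fact kernel_subproof (f : {linear V -> W}) :
  let P := fun x => f x = 0 in
  P 0 /\ forall a x y, P x -> P y -> P (a *: x + y).
Proof.
split=> [|a x y]; first exact: linear0.
by rewrite linearP => -> ->; rewrite scaler0 addr0.
Qed.

Definition kernel_submodule (f : {linear V -> W}) : submodule V :=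
  Submodule (kernel_subproof f).1 (kernel_subproof f).2.

Lemma fin_gen_surj (f : {linear V -> W}) :
  (forall y, exists x, y = f x) -> fin_gen V -> fin_gen W.
Proof.
move=> surj [n [e eP]]; exists n, (f \o e) => y.
have [x ->] := surj y; have [c ->] := eP x.
by exists c; rewrite linear_sum; apply: eq_bigr => i _; rewrite linearZ.
Qed.

End LinearMaps.

Section Adjoin.
Variables (R : comPzRingType) (V : lmodType R).
Implicit Types (N : submodule V) (x y : V).

Fact adjoin_subproof N z :
  let P := fun y => exists t, N (y - t *: z) in
  P 0 /\ forall a x y, P x -> P y -> P (a *: x + y).
Proof.
split=> [|a x y [s Ns] [t Nt]].
  by exists 0; rewrite scale0r subrr; apply: submodule0.
exists (a * s + t).
have -> : a *: x + y - (a * s + t) *: z = a *: (x - s *: z) + (y - t *: z).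
  by rewrite scalerDl opprD scalerBr scalerA addrACA.
exact: submoduleP.
Qed.

Definition adjoin N z : submodule V :=
  Submodule (adjoin_subproof N z).1 (adjoin_subproof N z).2.

Lemma adjoin_sub N z y : N y -> adjoin N z y.
Proof. by move=> Ny; exists 0; rewrite scale0r subr0. Qed.

Lemma adjoin_self N z : adjoin N z z.
Proof. by exists 1; rewrite scale1r subrr; apply: submodule0. Qed.

Definition zero_submodule : submodule V.
Proof.
exists (fun x => x = 0) => // a x y -> ->.
by rewrite scaler0 addr0.
Defined.

End Adjoin.

Arguments zero_submodule {R} V.

Lemma regular_fin_gen (R : comPzRingType) : fin_gen (R^o : lmodType R).
Proof.
exists 1%N, (fun=> 1) => x; exists (fun=> x).
by rewrite big_ord_recl big_ord0 addr0 /GRing.scale /= mulr1.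
Qed.

Lemma scale_linear (R : comPzRingType) (V : lmodType R) (x : V) :
  linear (fun r : R^o => (r : R) *: x).
Proof. by move=> a r s /=; rewrite scalerDl scalerA. Qed.

(** * Matlis duality with respect to [J] *)

Section Matlis.
Variables (R : comPzRingType) (hR : artinian R) (J : lmodType R).
Hypothesis hJ : minimal_injective_cogenerator J.

Let J_fin_gen : fin_gen J. Proof. by case: hJ => -[]. Qed.
Let J_inj : injective_mod J. Proof. by case: hJ => -[]. Qed.
Let J_cogen : cogenerator_mod J. Proof. by case: hJ => -[]. Qed.

(** The cogenerator property is applied to the map [r |-> r *: [x]] from [R] to [V / N] and to the
    zero map. *)
Lemma cogenerator_separates (V : lmodType R) (N : submodule V) (x : V) :
  fin_gen V -> ~ N x ->
  exists2 h : {linear V -> J}, (forall y, N y -> h y = 0) & h x <> 0.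
Proof.
move=> fgV Nx; apply: contrapT => noh; apply: Nx.
have fgQ : fin_gen (quotmod N).
  apply: (fin_gen_surj (f := to_quot N)) fgV => y.
  by exists (repr (y : quotmod N)); symmetry; apply: (to_quot_repr (y : quotmod N)).
have := @J_cogen _ _ (linear_of (scale_linear (to_quot N x))) \0%R
  (regular_fin_gen R) fgQ.
move=> /(_ _ 1) /=; rewrite scale1r -(linear0 (to_quot N)).
move=> sep; rewrite -[x]subr0; apply/to_quot_eq/sep => h r /=.
have [hx|hx] := pselect (h (to_quot N x) = 0).
  by rewrite linearZZ hx scaler0 linear0.
case: noh; exists (h \o to_quot N) => //= y Ny.
have -> : to_quot N y = to_quot N 0 by apply/to_quot_eq; rewrite subr0.
by rewrite !linear0.
Qed.

Lemma descending_stabilizes (V : lmodType R) : fin_gen V ->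
  forall I : nat -> submodule V, chain true I -> stabilizes I.
Proof. by move=> fgV; apply: fin_gen_chain_stabilizes fgV. Qed.

Fact annihilated_subproof (I : submodule R^o) :
  let P := fun x : J => forall r : R, I r -> r *: x = 0 in
  P 0 /\ forall a x y, P x -> P y -> P (a *: x + y).
Proof.
split=> [r _|a x y Px Py r Ir]; first exact: scaler0.
by rewrite scalerDr scalerA mulrC -scalerA Px // Py // scaler0 addr0.
Qed.

Definition annihilated (I : submodule R^o) : submodule J :=
  Submodule (annihilated_subproof I).1 (annihilated_subproof I).2.

(* An ideal is the annihilator of its annihilator in [J], so the artinian
   module [J] turns ascending chains of ideals into descending ones. *)
Lemma ascending_stabilizes (V : lmodType R) : fin_gen V ->
  forall I : nat -> submodule V, chain false I -> stabilizes I.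
Proof.
move=> fgV; apply: fin_gen_chain_stabilizes fgV => I cI.
have [|n st] := descending_stabilizes J_fin_gen (I := fun n => annihilated (I n)).
  by move=> n x annx r /cI; apply: annx.
exists n => m nm r; split; last exact: (chain_le cI _ nm).
move=> Imr; apply: contrapT => Inr.
have [h h0 []] := cogenerator_separates (regular_fin_gen R) Inr.
have hE (s : R) : h s = s *: h 1.
  by rewrite -linearZZ; congr (h _); rewrite /GRing.scale /= mulr1.
rewrite hE; apply: ((st m nm _).2 _ r Imr) => s Ins.
by rewrite -hE h0.
Qed.

Lemma has_minimal (V : lmodType R) (P : submodule V -> Prop) :
  fin_gen V -> (exists N, P N) ->
  exists2 N, P N &
    forall L, P L -> (forall x, L x -> N x) -> forall x, N x -> L x.
Proof.
move=> fgV exP; pose le (N L : submodule V) := forall x, L x -> N x.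
apply: (@extremal_of_stable _ le P _ exP) => I /(descending_stabilizes fgV) [n st].
by exists n => x /(st n.+1 (leqnSn n)).
Qed.

Lemma has_maximal (V : lmodType R) (P : submodule V -> Prop) :
  fin_gen V -> (exists N, P N) ->
  exists2 N, P N &
    forall L, P L -> (forall x, N x -> L x) -> forall x, L x -> N x.
Proof.
move=> fgV exP; pose le (N L : submodule V) := forall x, N x -> L x.
apply: (@extremal_of_stable _ le P _ exP) => I /(ascending_stabilizes fgV) [n st].
by exists n => x /(st n.+1 (leqnSn n)).
Qed.

(** A maximal finitely generated submodule of [N] absorbs each [x] in [N], since adjoining [x] keeps
    it finitely generated. *)
Lemma submod_fin_gen (V : lmodType R) (N : submodule V) :
  fin_gen V -> fin_gen (submod N).
Proof.
move=> fgV.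
pose P L := exists n (e : 'I_n -> submod N),
  forall x, L x <-> exists c : 'I_n -> R, x = \sum_(i < n) c i *: val (e i).
have [|L [n [e LE]] Lmax] := has_maximal (P := P) fgV.
  exists (zero_submodule V), 0%N, (fun=> 0) => x; split=> [->|[c ->]].
    by exists (fun=> 0); rewrite big_ord0.
  by rewrite big_ord0.
exists n, e => x.
have [c xE] : exists c : 'I_n -> R, val x = \sum_(i < n) c i *: val (e i).
  apply/LE/(Lmax (adjoin L (val x))); last exact: adjoin_self.
    exists n.+1, (fun i => if unlift ord0 i is Some j then e j else x) => y.
    split=> [[t] /LE [c yE]|[c ->]].
      exists (fun i => if unlift ord0 i is Some j then c j else t).
      rewrite big_ord_recl unlift_none; under eq_bigr do rewrite liftK.
      by rewrite -yE addrC subrK.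
    exists (c ord0); rewrite big_ord_recl unlift_none addrAC subrr add0r.
    by apply/LE; exists (c \o lift ord0); apply: eq_bigr => i _; rewrite liftK.
  by move=> y; apply: adjoin_sub.
exists c; apply: val_inj; rewrite xE linear_sum.
by apply: eq_bigr => i _; rewrite linearZZ.
Qed.

(* [G] is the graph of a linear map defined on a submodule of [V]. *)
Lemma extend_graph (V E : lmodType R) (G : V -> E -> Prop) :
  injective_mod E -> fin_gen V -> G 0 0 ->
  (forall a y z y' z', G y z -> G y' z' -> G (a *: y + y') (a *: z + z')) ->
  (forall z, G 0 z -> z = 0) ->
  exists h : {linear V -> E}, forall y z, G y z -> h y = z.
Proof.
move=> injE fgV G0 GP G0E.
have Guniq y z z' : G y z -> G y z' -> z = z'.
  move=> Gz Gz'; apply/eqP; rewrite -subr_eq0; apply/eqP/G0E.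
  have := GP (-1) _ _ _ _ Gz' Gz.
  by rewrite !scaleN1r addNr addrC.
pose D : submodule V := @Submodule _ _ (fun y => exists z, G y z)
  (ex_intro _ _ G0) (fun a y y' '(ex_intro z Gz) '(ex_intro z' Gz') =>
    ex_intro _ _ (GP a _ _ _ _ Gz Gz')).
have /choice[f Gf] (x : submod D) : exists z, G (val x) z.
  by have := (sub_predE _ _).1 (valP x).
have lin_f : linear f.
  by move=> a x y; apply: Guniq (Gf _) _; rewrite linearP; apply: (GP a); apply: Gf.
have [h hf] := injE _ _ (linear_of (f := val : submod D -> V) (linearP _))
  (linear_of lin_f) (submod_fin_gen D fgV) fgV val_inj.
exists h => y z Gyz.
have yD : y \in sub_pred D by apply/sub_predE; exists z.
have := hf (Sub y yD); rewrite /= => ->.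
by apply: Guniq (Gf _) _.
Qed.

(* The socle of [J] has multiplicity one: if [v] were independent of [u], a
   submodule [N] maximal with [v \in N] and [u \notin N] would be a direct
   summand of [J] and still an injective cogenerator, but [J], being artinian,
   does not embed in a proper submodule of itself. *)
Lemma simple_socle_unique (u v : J) :
  u <> 0 ->
  (forall r, r *: u <> 0 -> exists t, t *: (r *: u) = u) ->
  (forall r, r *: u = 0 -> r *: v = 0) ->
  exists s, v = s *: u.
Proof.
move=> u0 simple_u ann_uv; apply: contrapT => indep.
have [|N [Nv Nu] Nmax] :=
    has_maximal (P := fun N : submodule J => N v /\ ~ N u) J_fin_gen.
  exists (adjoin (zero_submodule J) v); split; first exact: adjoin_self.
  case=> s /eqP; rewrite subr_eq0 => /eqP usv.
  (* If [u = s *: v] and [t * s] fixes [u], then [1 - t * s] kills [u], hence [v], so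
     [v = t *: u]. *)
  have [|t tu] := simple_u s.
    by move/ann_uv; rewrite -usv.
  apply: indep; exists t; apply/eqP; rewrite -subr_eq0 [X in _ - t *: X]usv scalerA.
  rewrite -[X in X - _]scale1r -scalerBl; apply/eqP/ann_uv.
  by rewrite scalerBl -scalerA tu scale1r subrr.
have Nadj z : ~ N z -> exists t, N (u - t *: z).
  move=> Nz; apply: contrapT => Nadj; apply: Nz.
  apply: (Nmax (adjoin N z)); last exact: adjoin_self; last first.
    by move=> y; apply: adjoin_sub.
  by split; first exact: adjoin_sub.
(* The graph is the projection of [N + R u] onto [N] along [u]; the sum is direct because [R u] is
   simple and [u] is not in [N]. *)
have [|||f fP] := @extend_graph J J
    (fun y z => N z /\ exists r, y = z + r *: u) J_inj J_fin_gen.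
- by split; [apply: submodule0 | exists 0; rewrite scale0r addr0].
- move=> a _ z _ z' [Nz [r ->]] [Nz' [r' ->]]; split; first exact: submoduleP.
  by exists (a * r + r'); rewrite scalerDr scalerDl scalerA addrACA.
- move=> z [Nz [r /eqP]]; rewrite eq_sym addr_eq0 => /eqP zE.
  have [ru|/simple_u[t tu]] := pselect (r *: u = 0); first by rewrite zE ru oppr0.
  case: Nu; rewrite -tu -[r *: u]opprK -zE -scaleN1r scalerA.
  exact: submoduleZ.
have fN z : N z -> f z = z.
  by move=> Nz; apply: fP; split=> //; exists 0; rewrite scale0r addr0.
have fu : f u = 0.
  by apply: fP; split; [apply: submodule0 | exists 1; rewrite scale1r add0r].
have iter_linear (h : {linear J -> J}) n :
    exists g : {linear J -> J}, g =1 iter n h.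
  elim: n => [|n [g gE]]; first by exists idfun.
  by exists (h \o g) => x /=; rewrite gE.
(* [f] is the identity on [N] and kills [u]; the power [g] of [f] at which the
   kernels stabilize is a projection onto [N]. *)
have [g [gN gu gg]] : exists g : {linear J -> J},
    [/\ forall z, N z -> g z = z, g u = 0 & forall y, g (g y) = 0 -> g y = 0].
  have /choice[F FE] := iter_linear f.
  have [|n st] := ascending_stabilizes J_fin_gen (I := fun n => kernel_submodule (F n)).
    by move=> n x /=; rewrite !FE iterS => ->; rewrite linear0.
  (* The exponent [n.+1] guarantees at least one factor [f], which kills [u]. *)
  exists (F n.+1); split=> [z Nz||y].
  - by rewrite FE; elim: n.+1 => //= k ->; apply: fN.
  - by rewrite FE iterSr fu -FE linear0.
  - have eqn m : (n <= m)%N -> F m y = 0 <-> F n y = 0 by move=> /st /(_ y).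
    move=> h; apply/(eqn _ (leqnSn n))/(eqn (n.+1 + n.+1)%N); last by rewrite FE iterD -!FE.
    by rewrite addSn ltnW // ltnS leq_addr.
(* The image of [g] contains [N] but not [u], as [u = g z] would give [g (g z) = 0] and so [u = 0];
   maximality makes it equal to [N]. *)
have imN y : N (g y).
  apply: (Nmax (image_submodule g)); last by exists y.
    split=> [|[z uE]]; first by exists v; rewrite gN.
    by apply: u0; rewrite uE; apply: gg; rewrite -uE.
  by move=> z Nz; exists z; rewrite gN.
pose p := corestrict imN.
have pE x : val (p x) = g x by [].
have Ninj : injective_mod (submod N).
  move=> X Y i h fgX fgY inj_i.
  have [k kP] := J_inj (val \o h) fgX fgY inj_i.
  exists (p \o k) => x; apply: val_inj; rewrite pE.
  by rewrite (kP x : k (i x) = _) /= gN //; apply/sub_predE/valP.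
have Ncogen : cogenerator_mod (submod N).
  move=> X Y a b fgX fgY sep x; apply: contrapT => abx.
  have [|h _ hm] :=
      cogenerator_separates (N := zero_submodule Y) (x := a x - b x) fgY.
    by move/eqP; rewrite /= subr_eq0 => /eqP.
  have ghm : g (h (a x - b x)) = 0.
    rewrite -pE !linearB; apply/eqP; rewrite subr_eq0; apply/eqP.
    by congr val; apply: (sep (p \o h)).
  have [|t Nt] := Nadj (h (a x - b x)); first by move=> /gN; rewrite ghm => /esym.
  have uE : u = h (t *: (a x - b x)).
    have := gN _ Nt; rewrite linearB linearZZ /= ghm gu scaler0 subr0 => /esym /eqP.
    by rewrite subr_eq0 linearZZ => /eqP.
  (* Here [v] replaces [u]: whatever kills [t *: (a x - b x)] kills its image [u] under [h], hence
     [v], so sending that element to [v] is well defined and extends to a map [k] into [N]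
     separating [a] and [b]. *)
  pose v' : submod N := Sub v ((sub_predE N v).2 Nv).
  have [|||k kP] := @extend_graph Y (submod N) (fun y z => exists s,
      y = s *: (t *: (a x - b x)) /\ z = s *: v') Ninj fgY.
  - by exists 0; rewrite !scale0r.
  - move=> c _ _ _ _ [r [-> ->]] [r' [-> ->]]; exists (c * r + r').
    by rewrite !scalerDl !scalerA.
  - move=> z [r [r0 ->]]; apply: val_inj; rewrite linearZZ linear0.
    by apply: ann_uv; rewrite uE -linearZZ -r0 linear0.
  have : k (t *: (a x - b x)) = v' by apply: kP; exists 1; rewrite !scale1r.
  rewrite linearZZ linearB (sep k x : k (a x) = k (b x)) subrr scaler0.
  by move/(congr1 val) => /= v0; apply: indep; exists 0; rewrite scale0r -v0.
have [i inj_i] := hJ.2 _ (And3 (submod_fin_gen N J_fin_gen) Ninj Ncogen).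
pose j : {linear J -> J} := val \o i.
have inj_j : injective j by apply: inj_comp val_inj inj_i.
have /choice[F FE] := iter_linear j.
have [|n st] := descending_stabilizes J_fin_gen (I := fun n => image_submodule (F n)).
  by move=> n _ [x ->]; exists (j x); rewrite !FE iterSr.
(* Cancelling [n] copies of [j] in [F n u = F n.+1 z] puts [u] in the image of [j], inside [N]. *)
have [|z] := (st n.+1 (leqnSn n) (F n u)).2; first by exists u.
have inj_iter k : injective (iter k j) by elim: k => //= k IH; apply: inj_comp.
rewrite !FE iterSr => /inj_iter uE; apply: Nu.
by rewrite uE; apply/sub_predE/valP.
Qed.

(* Noetherian induction on [N], showing that [phi] is an evaluation on the
   annihilator of [N]: if [N' / N] is simple, generated by [x], then
   [h |-> h x] identifies the quotient of the annihilators of [N] and [N'] with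
   a simple submodule of [J], on which [phi] has to act by a scalar. *)
Lemma biduality_surjective (V : lmodType R) (phi : {linear dual J V -> J}) :
  fin_gen V -> exists x, forall h, phi h = dual_fun h x.
Proof.
move=> fgV; apply: contrapT => nophi.
pose perp (N : submodule V) (h : dual J V) := forall y, N y -> dual_fun h y = 0.
pose bad N := ~ exists x, forall h, perp N h -> phi h = dual_fun h x.
have [|N badN Nmax] := has_maximal (P := bad) fgV.
  exists (zero_submodule V) => -[x xP]; apply: nophi; exists x => h; apply: xP.
  by move=> y ->; rewrite linear0.
have dualDE (g h : dual J V) x : dual_fun (g + h) x = dual_fun g x + dual_fun h x.
  by rewrite /= /dual_comb_fun scale1r.
have dualZE a (h : dual J V) x : dual_fun (a *: h) x = a *: dual_fun h x.
  by rewrite /= /dual_comb_fun addr0.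
have [|N' [NN' [x [N'x Nx]]] N'min] := has_minimal
    (P := fun L => (forall y, N y -> L y) /\ exists y, L y /\ ~ N y) fgV.
  (* If nothing lies strictly above [N], then [N] is all of [V] and only the zero functional kills
     it. *)
  apply: contrapT => full; apply: badN; exists 0 => h hN.
  suff -> : h = 0 by rewrite (linear0 phi) (linear0 (dual_fun _)).
  apply: dualP => y; apply: hN; apply: contrapT => Ny; apply: full.
  exists (adjoin N y); split; first by move=> z; apply: adjoin_sub.
  by exists y; split; first exact: adjoin_self.
have N'adj z : ~ N z -> N' z -> forall y, N' y -> adjoin N z y.
  move=> Nz N'z; apply: N'min.
    split; first by move=> y; apply: adjoin_sub.
    by exists z; split=> //; apply: adjoin_self.
  move=> y [t /NN' N'y]; rewrite -[y](subrK (t *: z)).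
  by apply: submoduleD => //; apply: submoduleZ.
have [m mP] : exists m, forall h, perp N' h -> phi h = dual_fun h m.
  apply: contrapT => badN'; apply: Nx; exact: (Nmax N').
have [h0' h0N h0x] := cogenerator_separates fgV Nx.
pose h0 : dual J V := h0'.
pose u := dual_fun h0 x.
have ann_u r : r *: u = 0 -> N (r *: x).
  move=> ru; apply: contrapT => Nrx.
  have [t Nt] := N'adj _ Nrx (submoduleZ _ N'x) _ N'x.
  have := h0N _ Nt; rewrite linearB !(linearZZ h0') -[h0' x]/u ru scaler0 subr0.
  exact: h0x.
have simple_u r : r *: u <> 0 -> exists t, t *: (r *: u) = u.
  move=> ru; have Nrx : ~ N (r *: x) by move/h0N; rewrite (linearZZ h0').
  have [t Nt] := N'adj _ Nrx (submoduleZ _ N'x) _ N'x.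
  exists t; apply/esym/eqP; rewrite -subr_eq0.
  by have := h0N _ Nt; rewrite linearB !(linearZZ h0') => ->.
have dualCE (h : dual J V) r y :
    dual_fun (h - r *: h0) y = dual_fun h y - r *: dual_fun h0 y.
  by rewrite dualDE -(scaleNr r h0) dualZE scaleNr.
have sub_perp h r : perp N h -> dual_fun h x = r *: u -> perp N' (h - r *: h0).
  move=> hN hx y N'y; have [t Nt] := N'adj _ Nx N'x _ N'y.
  have zE (k : dual J V) : perp N k -> dual_fun k y = t *: dual_fun k x.
    move=> kN; apply/eqP; rewrite -subr_eq0 -(linearZZ (dual_fun k)).
    by rewrite -(linearB (dual_fun k)) kN.
  by rewrite dualCE !zE // hx !scalerA mulrC subrr.
(* If [r *: u = 0], then [r *: h0] kills [N'], where [phi] is evaluation at [m]; so [r] kills the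
   difference. *)
have [s sE] : exists s, phi h0 - dual_fun h0 m = s *: u.
  apply: simple_socle_unique => // r ru.
  have /mP : perp N' (r *: h0).
    rewrite -[r *: h0]subr0 -[0](scale0r h0).
    apply: sub_perp; last by rewrite scale0r dualZE.
    by move=> y Ny; rewrite dualZE h0N ?scaler0.
  by rewrite (linearZZ phi) dualZE scalerBr => ->; rewrite subrr.
(* With [h x = t *: u], the functional [h - t *: h0] kills [N'], so [phi h = h m + (t * s) *: u = h
   (m + s *: x)]. *)
apply: badN; exists (m + s *: x) => h hN.
have [t hx] : exists t, dual_fun h x = t *: u.
  by apply: simple_socle_unique => // r /ann_u /hN; rewrite (linearZZ (dual_fun h)).
have := mP _ (sub_perp _ _ hN hx).
rewrite (linearB phi) (linearZZ phi) dualCE => /eqP.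
rewrite subr_eq -addrA [- _ + _]addrC -scalerBr sE => /eqP ->.
by rewrite (linearD (dual_fun h)) (linearZZ (dual_fun h)) hx !scalerA mulrC.
Qed.

End Matlis.

(** * Descent to the stable category and naturality of [eta] *)

Section Duality.
Variables (R : comPzRingType) (J : lmodType R) (K : extricat R).
Implicit Types A B C : K.

(** The pair [(idm A, f)] is a morphism from the split extension to [d]; its middle map restricted
    to [B] is the lift. *)
Lemma factors_through_deflation A B P C (x : mor A P) (y : mor P C)
    (d : EE K C A) (f : mor B C) :
  realizes x y d -> pull f d = 0 -> exists g, f = y ** g.
Proof.
move=> rd fd; have [_ _ rmor rsplit _] := ext_realization K.
have [s] := (ext_additive K).2 A B.
have [|b [_ yb]] := rmor _ _ _ _ _ _ _ _ _ _ _ _ (idm A) f (rsplit _ _ s) rd.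
  by rewrite /ext_morphism push1 fd.
by exists (b ** Defs.bin2 s); rewrite mcompA yb -mcompA bpr2_in2 compm1.
Qed.

(** Such an [f] lifts along a deflation from a projective, so it factors through a projective. *)
Lemma relE_up_push_idealP C A B (d : EE K C A) (f : mor A B) :
  enough_projectives K -> relE_up (@proj_obj R K) C A d -> idealP K A B f ->
  push f d = 0.
Proof.
move=> enough dP fP; have [L [P [x [y [e [projP rd]]]]]] := enough B.
have [g ->] := factors_through_deflation rd (fP _ e).
by rewrite push_comp dP // push0.
Qed.

Variable T : right_ARS J K.

Lemma eta_ul A B (f : mor A B) (d : EE K B (T A)) :
  dual_fun (Defs.eta T A B (ul f)) d = eta_id T A (pull f d).
Proof. by rewrite -[ul f](compm1 (l := ul_cat K)) eta_natr upullE. Qed.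

(** Both sides are [eta (ul f)] at [d]: one naturality reads [f] as [idm B ** f], the other as
    [f ** idm A]. *)
Lemma bracket_fmap A B (f : mor A B) (d : EE K B (T A)) :
  bracket T d (fmap T (ul f)) = eta_id T A (pull f d).
Proof.
by rewrite -eta_ul -[ul f](comp1m (l := ul_cat K)) eta_natl /bracket comp1m.
Qed.

End Duality.

Theorem theorem1p3 (R : comPzRingType) (hR : artinian R)
    (J : lmodType R) (hJ : minimal_injective_cogenerator J)
    (K : extricat R) (hfin : ext_finite K)
    (hwic : weakly_idempotent_complete K)
    (T : right_ARS J K)
    (hproj : enough_projectives K) (hinj : enough_injectives K)
    (hQ : functorially_finite (@proj_obj R K))
    (hI : functorially_finite (@inj_obj R K))
    (C A : K) (d : submod (relE_up (@proj_obj R K) C A))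
    (f : mor A (T C : K)) :
  bracket T (sub_val d) (ol f) = bracket T (sub_val (phi T d)) (fmap T (ul f)).
Proof.
have dQ := (sub_predE _ _).1 (valP d).
have up0 (g : mor A (T C : K)) : idealP K A (T C : K) g -> phi_up_fun d g = 0.
  by move=> gP; rewrite /phi_up_fun relE_up_push_idealP ?linear0.
have [etai etaK etaiK] := eta_bij T A (T C : K).
pose up := quot_lift up0.
have lin_psi : linear (up \o etai).
  move=> a g h /=; rewrite -linearP; congr (up _).
  by apply: (can_inj etaK); rewrite linearP !etaiK.
have [e eP] := biduality_surjective hR hJ (linear_of lin_psi) (hfin (T A) (T C)).
have eE (g : mor A (T C : K)) :
    eta_id T A (pull g e) = eta_id T C (push g (sub_val d)).
  by rewrite -eta_ul -eP /= etaK; apply: quot_liftE.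
have eJ : relE_down (@inj_obj R K) (T C : K) (T A : K) e.
  move=> I c injI; apply: contrapT => ce.
  have [h _ []] := cogenerator_separates hJ
    (N := zero_submodule (EE K I (T A : K))) (hfin _ _) ce.
  (* Every functional on [E(I, tau A)] is [eta] of some [g : A -> I], and its value at [pull c e] is
     [eta_C] of the push of [d] along [c ** g], which passes through [E(C, I) = 0]. *)
  have [etai' _ etai'K] := eta_bij T A I.
  rewrite -[h (pull c e)]/(dual_fun (h : dual J _) _) -(etai'K h).
  rewrite -[etai' h]to_quot_repr eta_ul -pull_comp eE push_comp.
  by rewrite [push _ (sub_val d)]injI push0 linear0.
have phiP : phi_down T (phi T d) = phi_up T d.
  (* A solution exists, so the choice defining [phi] returns one and not the default [0]. *)
  apply: (@xgetPex _ _ [set e | phi_down T e = phi_up T d]%classic).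
  exists (Sub e ((sub_predE _ e).2 eJ)); apply: dualP => u /=.
  rewrite -[u]to_quot_repr [LHS]phi_downE [RHS]phi_upE.
  exact: eE.
by rewrite bracket_fmap -phi_downE phiP phi_upE /bracket opushE.
Qed.
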